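(* For all positive integers $m$ and $N$, the modular sweep map $\mathsf{sweep}_m:\mathcal{A}\to\mathcal{A}$ is a bijection, where $\mathcal{A}$ is the set of words of length $N$ over the alphabet $\{0,1,\ldots,m-1\}$.
   Context: For a word $\mathsf{w}=\mathsf{w}_1\mathsf{w}_2\cdots\mathsf{w}_N\in\mathcal{A}$ and $1\le j\le N$, the modular level of the letter $\mathsf{w}_j$ is $\ell_j:=\left(\sum_{i=1}^{j}\mathsf{w}_i\right)\bmod m\in\{0,\ldots,m-1\}$. The modular sweep map $\mathsf{sweep}_m:\mathcal{A}\to\mathcal{A}$ is defined as follows: start with the empty word $\mathsf{u}$; for $k=m-1,m-2,\ldots,1,0$ (in this order), read $\mathsf{w}$ from right to left and append to $\mathsf{u}$ every letter $\mathsf{w}_j$ whose modular level $\ell_j$ equals $k$. Then $\mathsf{sweep}_m(\mathsf{w}):=\mathsf{u}$ (a rearrangement of the letters of $\mathsf{w}$). *)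

(* Defs.v *)
From mathcomp Require Import all_boot.

Set Implicit Arguments.
Unset Strict Implicit.
Unset Printing Implicit Defensive.

(* Letters are indexed from 0: [tnth w j] is the letter w_{j+1}, so the sum
   below runs over all letters up to and including position j. *)
Definition level (m N : nat) (w : N.-tuple 'I_m) (j : 'I_N) : nat :=
  (\sum_(i < N | i <= j) (tnth w i : nat)) %% m.

Definition sweep_word (m N : nat) (w : N.-tuple 'I_m) : seq 'I_m :=
  flatten [seq [seq tnth w j | j <- rev (enum 'I_N) & level w j == k]
          | k <- rev (iota 0 m)].

Lemma ltn_level (m N : nat) (w : N.-tuple 'I_m) (j : 'I_N) : level w j < m.
Proof. by rewrite ltn_pmod // (leq_ltn_trans _ (ltn_ord (tnth w j))). Qed.

Lemma perm_sweep_word (m N : nat) (w : N.-tuple 'I_m) :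
  perm_eq (sweep_word w) w.
Proof.
apply/permP => a; rewrite /sweep_word count_flatten -map_comp sumnE big_map.
rewrite (eq_bigr (fun k => \sum_(j < N | a (tnth w j)) (level w j == k)))
  => [|k _]; last first.
  rewrite /= count_map count_filter count_rev -sum1_count big_enum_cond /=.
  by rewrite [RHS]big_mkcond /= big_mkcond; apply: eq_bigr => j _ /=;
     case: (a _); case: (_ == k).
rewrite exchange_big /= -[in RHS](map_tnth_enum w) count_map -sum1_count big_enum_cond /=.
apply: eq_bigr => j _.
rewrite -big_mkcond /= sum1_count (@eq_count _ _ (pred1 (level w j))); last first.
  by move=> k; rewrite /= eq_sym.
by rewrite count_rev count_uniq_mem ?iota_uniq // mem_iota ltn_level.
Qed.

Lemma size_sweep_word (m N : nat) (w : N.-tuple 'I_m) :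
  size (sweep_word w) == N.
Proof. by rewrite (perm_size (perm_sweep_word w)) size_tuple. Qed.

Definition sweep (m N : nat) (w : N.-tuple 'I_m) : N.-tuple 'I_m :=
  Tuple (size_sweep_word w).

(* Main.v *)
Require Import Defs.
From mathcomp Require Import all_boot.
From mathcomp Require Import zify.

Set Implicit Arguments.
Unset Strict Implicit.
Unset Printing Implicit Defensive.

(* By finiteness it suffices to prove surjectivity. Writing u as a sweep amounts
   to cutting it into m consecutive blocks, block k holding the letters of level
   k (a nonincreasing level function L), such that the walk that starts at the
   level of the total and, at level l, reads the next unread letter d of block l
   and moves to l - d, reads all of u.
   A letter d of level l is an edge from l - d to l, and the blocks are called
   equitable when these edges pass over each residue as often as a single edge
   from 0 to the total does. Raising the first letter of level k - 1 to level k
   adds one crossing of k and removes one crossing elsewhere; starting from all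
   letters at level 0 and raising letters towards deficient levels, one never
   creates an excess at a level in use, which forces an equitable state in the
   end. Finally, in an equitable L with minimal sum the walk reads everything:
   otherwise it gets stuck at 0, the unread letters have as many arrivals as
   departures at every level, and lowering all of them by one level gives a
   smaller equitable L. *)

Section Sweep.

(** * Crossings of residues by one edge *)

Variables (m N : nat) (a : 'I_N -> nat).
Hypothesis m_gt0 : 0 < m.

(* The number of integers congruent to k in the interval (l - d, l]. *)
Definition cross (l d k : nat) : nat := \sum_(b < d) (k + b == l %[mod m]).

(** Both sides count the [b <= d] with [k + b] congruent to [l], splitting off the last or the first
    [b]. *)
Lemma crossSr l d k :
  cross l d k + (k + d == l %[mod m]) = (k == l %[mod m]) + cross l d k.+1.
Proof.
rewrite /cross -(big_ord_recr d (fun b => nat_of_bool (k + b == l %[mod m]))).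
rewrite big_ord_recl /= addn0; congr (_ + _).
by apply: eq_bigr => b _; rewrite /bump /= add1n addnS addSn.
Qed.

Lemma crossSS l d k : cross l.+1 d k.+1 = cross l d k.
Proof.
by apply: eq_bigr => b _; rewrite addSn -[_.+1]addn1 -[l.+1]addn1 eqn_modDr.
Qed.

Lemma cross_mod l d k : cross l d (k %% m) = cross l d k.
Proof. by apply: eq_bigr => b _; rewrite modnDml. Qed.

Lemma sum_eq_mod x : \sum_(k < m) (k == x %[mod m]) = 1.
Proof.
have xm : x %% m < m by rewrite ltn_mod.
rewrite (bigD1 (Ordinal xm)) //= modn_mod eqxx big1 // => k.
by rewrite -val_eqE /= (modn_small (ltn_ord k)) => /negPf ->.
Qed.

Lemma sum_cross l d : \sum_(k < m) cross l d k = d.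
Proof.
rewrite exchange_big /= (eq_bigr (fun=> 1)) ?sum1_card ?card_ord // => b _.
rewrite -[RHS](sum_eq_mod (l + (m - b %% m))); apply: eq_bigr => k _.
congr nat_of_bool; rewrite -(eqn_modDr (m - b %% m)) -addnA.
rewrite -[in LHS]modnDmr -(modnDml b) subnKC ?modnn ?addn0 //.
by rewrite ltnW // ltn_mod.
Qed.

(** * Flow of a level function and its target *)

Definition total := \sum_i a i.
Definition flow (L : 'I_N -> nat) k := \sum_i cross (L i) (a i) k.
Definition target k := cross total total k.

Lemma sum_flow L : \sum_(k < m) flow L k = \sum_(k < m) target k.
Proof.
rewrite sum_cross exchange_big /=.
by apply: eq_bigr => i _; rewrite sum_cross.
Qed.

Lemma flowSr L k :
  flow L k + \sum_i (k + a i == L i %[mod m])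
  = \sum_i (k == L i %[mod m]) + flow L k.+1.
Proof.
by rewrite -!big_split; apply: eq_bigr => i _ /=; rewrite crossSr.
Qed.

Lemma targetSr k :
  target k + (k == 0 %[mod m]) = (k == total %[mod m]) + target k.+1.
Proof. by rewrite -crossSr -(eqn_modDr total k 0) add0n. Qed.

Lemma target_nonincr k : 0 < k < m -> target k.+1 <= target k.
Proof.
move=> /andP[k0 km]; have := targetSr k.
by rewrite mod0n (modn_small km) (gtn_eqF k0); lia.
Qed.

Lemma flow_m L : flow L m = flow L 0.
Proof. by apply: eq_bigr => i _; rewrite -cross_mod modnn. Qed.

Lemma target_m : target m = target 0.
Proof. by rewrite /target -cross_mod modnn. Qed.

Lemma homo_succ_chain (r : rel nat) (f : nat -> nat) p q :
  reflexive r -> transitive r -> p <= q ->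
  (forall j, p <= j < q -> r (f j) (f j.+1)) -> r (f p) (f q).
Proof.
move=> rr rt; elim: q => [|q IH]; first by rewrite leqn0 => /eqP->.
rewrite leq_eqVlt => /predU1P[-> //|]; rewrite ltnS => pq le_f.
apply: (rt (f q)); last by rewrite le_f // pq ltnSn.
by apply: IH => // j /andP[pj jq]; rewrite le_f // pj (ltn_trans jq).
Qed.

(** From [k] up to [m], which is residue 0, the target never increases. *)
Lemma target0_le k : k < m -> target 0 <= target k.
Proof.
case: k => // k km; rewrite -target_m.
have le_t j : k.+1 <= j < m -> target j.+1 <= target j.
  by move=> /andP[kj jm]; apply: target_nonincr; rewrite jm (leq_trans _ kj).
apply: (@homo_succ_chain geq target); [exact: leqnn | | exact: ltnW | exact: le_t].
by move=> x y z xy yz; exact: leq_trans yz xy.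
Qed.

(** An edge that crosses [k] without ending there also crosses [k.+1]. *)
Lemma flow_le_empty L k : (forall i, L i < m) -> k < m ->
  (forall i, L i != k) -> flow L k <= flow L k.+1.
Proof.
move=> Lm km Lk; have := flowSr L k; rewrite [X in _ = X + _]big1; first by lia.
by move=> i _; rewrite !modn_small // eq_sym (negPf (Lk i)).
Qed.

Lemma leq_sum_eq (f g : nat -> nat) :
  (forall k, k < m -> f k <= g k) -> \sum_(k < m) f k = \sum_(k < m) g k ->
  forall k, k < m -> f k = g k.
Proof.
move=> le_fg eq_s k km.
have /leqif_sum[_] : forall i : 'I_m, true -> f i <= g i ?= iff (f i == g i).
  by move=> i _; apply: leqif_eq; apply: le_fg.
by rewrite eq_s eqxx => /esym/forallP/(_ (Ordinal km))/= /eqP.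
Qed.

(** * Existence of an equitable level function *)

Definition level_fun (L : 'I_N -> nat) :=
  (forall i, L i < m) /\ (forall i j : 'I_N, i <= j -> L j <= L i).

Definition equitable L := forall k, k < m -> flow L k = target k.

Definition no_excess L :=
  forall k, 0 < k < m -> (exists i, k <= L i) -> flow L k <= target k.

(** Above the highest level in use the flow is nondecreasing up to residue [m], hence bounded by
    [flow L 0], and [target 0] is the least target. *)
Lemma flow_le_target L : level_fun L -> no_excess L ->
  flow L 0 <= target 0 -> forall k, k < m -> flow L k <= target k.
Proof.
move=> [Lm Lmono] Lex L0 [//|k] km.
have [/existsP ex|/existsPn nex] := boolP [exists i, k.+1 <= L i].
  exact: Lex.
apply: leq_trans (leq_trans _ L0) (target0_le km); rewrite -flow_m.
apply: (@homo_succ_chain leq (flow L));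
  [exact: leqnn | by move=> x y z; apply: leq_trans | exact: ltnW |].
move=> j /andP[kj jm]; apply: flow_le_empty => // i.
by apply: contraNneq (nex i) => ->.
Qed.

Lemma raise_step L : level_fun L -> no_excess L ->
  equitable L \/ exists2 L', level_fun L' /\ no_excess L' &
    \sum_i L' i = (\sum_i L i).+1.
Proof.
move=> HL Lex; have [Lm Lmono] := HL.
have [L0|L0] := leqP (flow L 0) (target 0).
  left; apply: leq_sum_eq (sum_flow L); exact: flow_le_target.
right.
(* As the sums agree, the excess at 0 forces a deficit; [k] is the least deficient level. *)
have [k /and3P[k0 km kdef] kmin] :
    exists2 k, [&& 0 < k, k < m & flow L k < target k]
      & forall j, 0 < j -> j < k -> target j <= flow L j.
  have ex : exists k, [&& 0 < k, k < m & flow L k < target k].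
    have [/existsP[k Hk]|/existsPn nex] :=
        boolP [exists k : 'I_m, (0 < k) && (flow L k < target k)].
      by exists k; rewrite ltn_ord.
    suff eqt : target 0 = flow L 0 by rewrite eqt ltnn in L0.
    apply: (@leq_sum_eq target (flow L)) => // [[|k] km|].
    - exact: ltnW.
    - by have := nex (Ordinal km); rewrite /= -leqNgt.
    - by rewrite sum_flow.
  exists (ex_minn ex); case: ex_minnP => // k Hk kmin j j0 jk.
  rewrite leqNgt; apply: contraL (jk) => jdef; rewrite -leqNgt; apply: kmin.
  by rewrite j0 jdef andbT (ltn_trans jk) //; case/and3P: Hk.
(* If level [k.-1] were empty, the deficit at [k] would pass down to [k.-1], against [kmin], or
   against the excess at 0 when [k = 1]. *)
have [/existsP[i0 Li0]|/existsPn nex] := boolP [exists i, L i == k.-1]; last first.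
  case: k k0 km kdef kmin nex => // k _ km kdef kmin nex.
  have le_k : flow L k <= flow L k.+1.
    by apply: flow_le_empty => //; apply: ltnW.
  case: k => [|k] in km kdef kmin nex le_k *.
    have := targetSr 0; rewrite eqxx => tS.
    by exfalso; lia.
  have := kmin k.+1 isT (ltnSn _).
  have := @target_nonincr k.+1 (ltnW km); lia.
(* Taking the first letter of its level keeps the levels nonincreasing. *)
pose i1 := [arg min_(i < i0 | L i == k.-1) (i : nat)].
have [Li1 i1min] : L i1 = k.-1 /\ forall j : 'I_N, L j = k.-1 -> i1 <= j.
  rewrite /i1; case: arg_minnP => // i /eqP Li imin; split=> // j Lj.
  by apply: imin; apply/eqP.
exists (fun i => L i + (i == i1)); last first.
  rewrite big_split /= addnC (bigD1 i1) //= eqxx big1 // => i /negPf -> //.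
split.
  split=> [i|i j ij]; first by have := Lm i; case: eqP => [->|_]; lia.
  have := Lmono _ _ ij.
  have [->|ni] := eqVneq i i1; have [jE|nj] := eqVneq j i1; rewrite ?jE; try lia.
  subst j; have := i1min i; have : (i : nat) != i1 by [].
  lia.
have flow1 j : j < m ->
    flow (fun i => L i + (i == i1)) j <= flow L j + (j == k).
  move=> jm; rewrite /flow (bigD1 i1) //= [in X in _ <= X](bigD1 i1) //= eqxx.
  rewrite [X in _ + X <= _](eq_bigr (fun i => cross (L i) (a i) j)); last first.
    by move=> i /negPf->; rewrite addn0.
  have := crossSr (L i1).+1 (a i1) j; rewrite crossSS addn1 Li1 prednK //.
  rewrite (modn_small jm) (modn_small km) addnAC leq_add2r => flow_i1.
  by rewrite [leqRHS]addnC -flow_i1 leq_addr.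
(* A new excess at [j] excludes [j = k], so it was there before and all old levels lie below [j];
   the raised letter only reaches [k]. *)
move=> j /andP[j0 jm] [i]; apply: contraTT => nle; rewrite -ltnNge in nle.
have := flow1 j jm.
have [jk|njk] := eqVneq j k; first by rewrite -jk in kdef; lia.
rewrite addn0 => le_j.
have ni : ~ (j <= L i).
  move=> jL; have := Lex j; rewrite j0 jm => /(_ isT (ex_intro _ i jL)); lia.
have [Ei|] := eqVneq i i1; last by lia.
move: ni njk k0; rewrite Ei Li1 /=; lia.
Qed.

(** Each raise adds 1 to the sum of levels, which is at most [N * m]. *)
Lemma exists_equitable : exists2 L, level_fun L & equitable L.
Proof.
suff gen n L : level_fun L -> no_excess L -> N * m <= n + \sum_i L i ->
    exists2 L, level_fun L & equitable L.
  apply: (gen (N * m) (fun=> 0)); last exact: leq_addr.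
    by split.
  by move=> k /andP[k0 _] [_]; rewrite leqNgt k0.
elim: n L => [|n IH] L HL Lex bound;
  have [Leq|[L' [HL' Lex'] sumL']] := raise_step HL Lex.
- by exists L.
- have : \sum_i L' i <= \sum_(i < N) m.
    by apply: leq_sum => i _; apply: ltnW; case: HL'.
  by rewrite sum_nat_const card_ord sumL'; lia.
- by exists L.
- by apply: (IH L') => //; rewrite sumL'; lia.
Qed.

(** * Degree balance and trails *)

Lemma equitable_mod L k : equitable L -> flow L k = target k.
Proof.
move=> Leq; transitivity (flow L (k %% m)).
  by apply: eq_bigr => i _; rewrite cross_mod.
by rewrite Leq ?ltn_mod // /target cross_mod.
Qed.

Lemma equitable_balance L k : equitable L ->
  \sum_i (k == L i %[mod m]) + (k == 0 %[mod m])
  = (k == total %[mod m]) + \sum_i (k + a i == L i %[mod m]).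
Proof.
move=> Leq; have := flowSr L k; have := targetSr k.
rewrite !equitable_mod //; lia.
Qed.

(* A trail is a partial walk, listed in reverse order of reading, i.e. in the
   order in which its letters occur in the preimage word. *)
Fixpoint trail L (s : seq 'I_N) : bool :=
  if s is i :: s' then
    [&& trail L s', L i + \sum_(j <- s') a j == total %[mod m] &
        [forall j : 'I_N, (L j == L i) ==> ((j < i) == (j \in s'))]]
  else true.

Lemma trail_uniq L s : trail L s -> uniq s.
Proof.
elim: s => //= i s IH /and3P[/IH-> _ /forallP/(_ i)].
by rewrite eqxx ltnn andbT /= => /eqP <-.
Qed.

Lemma trail_lower L s i j :
  trail L s -> i \in s -> L j = L i -> j <= i -> j \in s.
Proof.
elim: s => //= x s IH /and3P[/IH{}IH _ /forallP lt_x].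
rewrite !inE => /predU1P[->|si] Lj ji; last by rewrite IH ?orbT.
have [//|jx] := eqVneq j x; have := lt_x j.
by rewrite Lj eqxx /= => /eqP<-; rewrite ltn_neqAle ji andbT.
Qed.

Lemma trail_sorted L s k :
  trail L s -> sorted (fun i j : 'I_N => i < j) [seq i <- rev s | L i == k].
Proof.
move=> tr; rewrite sorted_pairwise; last by move=> x y z; apply: ltn_trans.
elim: s tr => //= i s IH /and3P[/IH{}IH _ /forallP lt_i].
rewrite rev_cons -cats1 filter_cat pairwise_cat IH /=.
case: eqP => //= Li; rewrite ?allrel0r // andbT.
apply/allrelP => x y; rewrite mem_filter mem_rev inE => /andP[/eqP Lx sx] /eqP->.
by have := lt_i x; rewrite Lx Li eqxx /= sx => /eqP.
Qed.

(** The edges of [s] form a walk from [c] to [total], so their degrees balance like those of one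
    such edge. *)
Lemma trail_balance L s c k :
  trail L s -> c + \sum_(j <- s) a j = total %[mod m] ->
  \sum_(i <- s) (k == L i %[mod m]) + (k == c %[mod m])
  = (k == total %[mod m]) + \sum_(i <- s) (k + a i == L i %[mod m]).
Proof.
elim: s c => [|i s IH] c /=.
  by rewrite !big_nil addn0 => _ ->; rewrite addn0.
move=> /and3P[/IH{}IH /eqP Li _]; rewrite !big_cons => cE.
have -> : (k == c %[mod m]) = (k + a i == L i %[mod m]).
  rewrite -(eqn_modDr (a i) k c); congr (_ == _).
  by apply/eqP; rewrite -(eqn_modDr (\sum_(j <- s) a j)) -addnA cE Li.
rewrite [X in X + _]addnC (IH _ Li) -addnA; congr (_ + _); exact: addnC.
Qed.

Lemma exists_stuck_trail L : level_fun L -> exists s c,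
  [/\ trail L s, c < m, c + \sum_(j <- s) a j = total %[mod m]
    & forall i, L i = c -> i \in s].
Proof.
move=> [Lm Lmono].
suff gen n s : trail L s -> N <= n + size s -> exists s c,
    [/\ trail L s, c < m, c + \sum_(j <- s) a j = total %[mod m]
      & forall i, L i = c -> i \in s].
  by apply: (gen N [::]) => //; rewrite addn0.
elim: n s => [|n IH] s tr bound.
(* [c] is the residue of [total - S], where the walk now stands. *)
all: pose S := \sum_(j <- s) a j; pose c := (total + (m - S %% m)) %% m.
all: have cm : c < m by rewrite ltn_mod.
all: have cS : c + S = total %[mod m].
1,3: rewrite /c modnDml -addnA -modnDmr -(modnDmr _ S) subnK ?modnn ?addn0 //.
1,2: by rewrite ltnW // ltn_mod.
- exists s, c; split=> // i _.
  suff /(uniq_min_size (trail_uniq tr)) : {subset s <= enum 'I_N}.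
    by rewrite size_enum_ord => /(_ bound)[_ ->]; rewrite mem_enum.
  by move=> x; rewrite mem_enum.
have [/existsP[i0 Hi0]|/existsPn stuck] :=
    boolP [exists i, (L i == c) && (i \notin s)]; last first.
  exists s, c; split=> // i Li; have := stuck i.
  by rewrite Li eqxx /= negbK.
pose i := [arg min_(i < i0 | (L i == c) && (i \notin s)) (i : nat)].
have [/eqP Li is_ imin] : [/\ L i == c, i \notin s &
    forall j : 'I_N, L j = c -> j \notin s -> i <= j].
  rewrite /i; case: arg_minnP => // x /andP[Lx sx] xmin; split=> // j Lj sj.
  by apply: xmin; rewrite Lj eqxx.
apply: (IH (i :: s)); last by rewrite /=; lia.
rewrite /=; apply/and3P; split=> //; first by rewrite Li; apply/eqP.
apply/forallP => j; rewrite Li; apply/implyP => /eqP Lj.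
apply/eqP; apply/idP/idP => [ji|sj].
  by apply: contraTT ji => sj; rewrite -leqNgt imin.
rewrite ltnNge; apply: contra is_ => ij.
by apply: (trail_lower tr sj) => //; rewrite Lj Li.
Qed.

Lemma sum_uniq_compl (s : seq 'I_N) (F : 'I_N -> nat) : uniq s ->
  \sum_i F i = \sum_(i <- s) F i + \sum_(i | i \notin s) F i.
Proof. by move=> us; rewrite (bigID (mem s)) /= big_uniq. Qed.

(** * Lowering the unread letters *)

Lemma lower_step L : level_fun L -> equitable L ->
  (exists2 s, trail L s & forall i, i \in s) \/
  exists2 L', level_fun L' /\ equitable L' & \sum_i L' i < \sum_i L i.
Proof.
move=> HL Leq; have [Lm Lmono] := HL.
have [s [c [tr cm cS stuck]]] := exists_stuck_trail HL.
have us := trail_uniq tr.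
have [/forallP full|/forallPn[i0 ni0]] := boolP [forall i, i \in s].
  by left; exists s.
right.
have bal k := equitable_balance k Leq.
have tbal k := trail_balance k tr cS.
(* No unread letter has level [c], so subtracting the two balances at [c] leaves [(c == 0)] equal to
   1 plus the unread departures. *)
have c0 : c = 0.
  have := bal c; have := tbal c; rewrite !(sum_uniq_compl _ us).
  rewrite [X in _ + X + _]big1 => [|i ns]; last first.
    rewrite !modn_small //; apply/eqP; rewrite eqb0.
    by apply: contra ns => /eqP ci; apply: stuck.
  rewrite eqxx mod0n (modn_small cm).
  move: (c == total %% m) (\sum_(i <- s) _) (\sum_(i <- s) _) (\sum_(i | _) _).
  by move=> e x y z; lia.
have unused k : \sum_(i | i \notin s) (k == L i %[mod m])
    = \sum_(i | i \notin s) (k + a i == L i %[mod m]).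
  have := bal k; have := tbal k; rewrite c0 !(sum_uniq_compl _ us).
  move: (\sum_(i <- s) _) (\sum_(i <- s) _) (\sum_(i | _) _) (\sum_(i | _) _).
  move: (k == 0 %[mod m]) (k == total %[mod m]) => x y z t v w.
  by lia.
have Lpos i : i \notin s -> 0 < L i.
  by rewrite lt0n; apply: contra => /eqP Li; apply: stuck; rewrite Li c0.
exists (fun i => L i - (i \notin s)); last first.
  rewrite (bigD1 i0) //= [X in _ < X](bigD1 i0) //= -addSn.
  apply: leq_add; last by apply: leq_sum => i _; apply: leq_subr.
  by have := Lpos _ ni0; rewrite ni0; lia.
split; first split=> [i|i j ij]; first exact: leq_ltn_trans (leq_subr _ _) (Lm i).
  have := Lmono _ _ ij; rewrite leq_eqVlt => /predU1P[Lij|]; last by lia.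
  rewrite Lij; apply: leq_sub2l.
  have [sj|_] := boolP (j \in s); last exact: leq_b1.
  by rewrite (trail_lower tr sj (esym Lij) ij).
move=> k km; rewrite -Leq //; apply/eqP.
rewrite /flow (bigID (mem s)) [X in _ == X](bigID (mem s)) /=.
rewrite (eq_bigr (fun i => cross (L i) (a i) k)); last by move=> i ->; rewrite subn0.
rewrite eqn_add2l -(eqn_add2r (\sum_(i | i \notin s) (k == L i %[mod m]))).
rewrite [in X in _ == X]unused -!big_split /=; apply/eqP; apply: eq_bigr => i ns.
rewrite crossSr addnC; congr (_ + _).
by rewrite ns -[X in cross X _ _.+1](prednK (Lpos i ns)) crossSS subn1.
Qed.

Lemma exists_full_trail :
  exists2 L, level_fun L & exists2 s, trail L s & forall i, i \in s.
Proof.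
have [L] := exists_equitable; have [n] := ubnP (\sum_i L i).
elim: n L => // n IH L; rewrite ltnS => bound HL Leq.
have [full|[L' [HL' Leq'] lt_L']] := lower_step HL Leq; first by exists L.
by apply: (IH L') => //; apply: leq_trans lt_L' bound.
Qed.

(** * The preimage word and bijectivity *)

(** The concatenation contains every position and increases, within a level by [trail_sorted] and
    between levels by monotonicity of [L]. *)
Lemma flatten_levels L s : level_fun L -> trail L s -> (forall i, i \in s) ->
  flatten [seq [seq i <- rev s | L i == k] | k <- rev (iota 0 m)] = enum 'I_N.
Proof.
move=> [Lm Lmono] tr full.
have lt_tr : transitive (fun i j : 'I_N => i < j) by move=> x y z; apply: ltn_trans.
pose F n := flatten [seq [seq i <- rev s | L i == k] | k <- rev (iota 0 n)].
have FS n : F n.+1 = [seq i <- rev s | L i == n] ++ F n.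
  by rewrite /F -addn1 iotaD rev_cat map_cat flatten_cat /= cats0.
have memF n i : (i \in F n) = (L i < n).
  elim: n => // n IH.
  by rewrite FS mem_cat mem_filter mem_rev full andbT IH ltnS [in RHS]leq_eqVlt.
have sortF n : pairwise (fun i j : 'I_N => i < j) (F n).
  elim: n => // n IH; rewrite FS pairwise_cat IH andbT -sorted_pairwise //.
  rewrite trail_sorted // andbT; apply/allrelP => x y.
  rewrite mem_filter memF => /andP[/eqP<- _]; rewrite !ltnNge.
  by apply: contra; apply: Lmono.
apply: (irr_sorted_eq lt_tr); first by move=> x; rewrite /= ltnn.
- by rewrite sorted_pairwise // sortF.
- by have := iota_ltn_sorted 0 N; rewrite -val_enum_ord sorted_map.
- by move=> i; rewrite memF Lm mem_enum.
Qed.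

Lemma trail_nth L s x0 n : trail L s -> n < size s ->
  L (nth x0 s n) + \sum_(i <- drop n.+1 s) a i = total %[mod m].
Proof.
elim: s n => //= i s IH [|n] /and3P[tr /eqP Li _] sn; last exact: IH.
by rewrite drop0.
Qed.

(** [total] is the sum along [t]; cancelling the letters after [j] leaves the prefix sum. *)
Lemma trail_level L (t : N.-tuple 'I_N) (j : 'I_N) :
  trail L t -> (forall i, i \in tval t) ->
  L (tnth t j) = \sum_(i < N | i <= j) a (tnth t i) %[mod m].
Proof.
move=> tr full; have jt : j < size t by rewrite size_tuple.
have := trail_nth (tnth t j) tr jt; rewrite -tnth_nth.
have -> : total = \sum_(i <- t) a i.
  rewrite /total (sum_uniq_compl a (trail_uniq tr)) [X in _ + X]big1 ?addn0 //.
  by move=> i; rewrite full.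
rewrite -[in X in _ = X -> _](cat_take_drop j.+1 t) big_cat /=.
move=> /eqP; rewrite eqn_modDr => /eqP ->; congr (_ %% _).
rewrite (big_nth (tnth t j)) big_mkord size_takel //.
rewrite (big_ord_widen _ (fun i => a (nth _ (take j.+1 t) i)) (ltn_ord j)).
by apply: eq_bigr => i ij; rewrite nth_take // -tnth_nth.
Qed.

End Sweep.

Lemma sweep_surjective m N (u : N.-tuple 'I_m) : 0 < m ->
  exists w, sweep w = u.
Proof.
move=> m_gt0; pose a (i : 'I_N) : nat := tnth u i.
have [L HL [s tr full]] := exists_full_trail a m_gt0.
have us := trail_uniq tr.
have sz : size s == N.
  rewrite -(card_uniqP us) -[X in _ == X](card_ord N); apply/eqP.
  by apply: eq_card => i; rewrite full.
pose t := Tuple sz; exists (map_tuple (tnth u) t); apply/val_inj => /=.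
have lvl j : level (map_tuple (tnth u) t) j = L (tnth t j).
  rewrite -[RHS](@modn_small _ m); last by case: HL.
  rewrite (@trail_level m N a L t j tr full) //; congr (_ %% _).
  by apply: eq_bigr => i _; rewrite tnth_map.
rewrite /sweep_word -[RHS](map_tnth_enum u) -[in RHS](flatten_levels HL tr full).
rewrite map_flatten -map_comp; congr flatten; apply: eq_map => k /=.
rewrite -[s in RHS]/(tval t) -(map_tnth_enum t) -map_rev filter_map -map_comp.
rewrite (@eq_filter _ _ (preim (tnth t) (fun i => L i == k))) => [|j] /=;
  last by rewrite lvl.
by apply: eq_map => j; rewrite tnth_map.
Qed.

Theorem theorem1p4 (m N : nat) (hm : 0 < m) (hN : 0 < N) :
  bijective (@sweep m N).
Proof.
have ex (u : N.-tuple 'I_m) : exists w, sweep w == u.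
  by have [w /eqP] := sweep_surjective u hm; exists w.
pose g (u : N.-tuple 'I_m) : N.-tuple 'I_m := xchoose (ex u).
have gK : cancel g (@sweep m N) by move=> u; apply/eqP/(xchooseP (ex u)).
(* On a finite set the injective section [g] is bijective, hence so is [sweep]. *)
exact: (bij_can_bij (injF_bij (can_inj gK)) gK).
Qed.
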